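(* Let $p,q\geqslant 1$ be real numbers and let $d$ be a positive integer. For all $\mathbf{x},\mathbf{y}\in\mathbb{R}^d$ and all $\mu,\nu\in\mathcal{P}_{q,p}(\mathbb{R})$, $$W_{q,p}(\delta_{\mathbf{x}}\times\mu,\delta_{\mathbf{y}}\times\nu)=\left\{\int_0^1 c\left(F_\mu^{-1}(t)-F_\nu^{-1}(t)\right)dt\right\}^{1/q},$$ where $c(z)=\left(\|\mathbf{x}-\mathbf{y}\|_p^p+|z|^p\right)^{q/p}$ for $z\in\mathbb{R}$.
   Context: For a positive integer $k$ and real $p,q\geqslant1$, $\|\cdot\|_p$ denotes the $\ell_p$ norm on $\mathbb{R}^k$, and $\mathcal{P}_{q,p}(\mathbb{R}^k)$ is the set of (Borel) probability measures on $\mathbb{R}^k$ with finite moment of order $q$ with respect to $\|\cdot\|_p$, i.e. $\int\|\mathbf{u}\|_p^q\,d\mu(\mathbf{u})<\infty$. For $\mu,\nu\in\mathcal{P}_{q,p}(\mathbb{R}^k)$, $\Pi(\mu,\nu)$ is the set of all probability measures on $\mathbb{R}^k\times\mathbb{R}^k$ with first marginal $\mu$ and second marginal $\nu$. The Wasserstein distance is $$W_{q,p}(\mu,\nu)=\left(\inf_{\pi\in\Pi(\mu,\nu)}\int\|\mathbf{u}-\mathbf{v}\|_p^q\,d\pi(\mathbf{u},\mathbf{v})\right)^{1/q}.$$ For $\mathbf{x}\in\mathbb{R}^d$, $\delta_{\mathbf{x}}$ is the probability measure giving mass one to the point $\mathbf{x}$ (Dirac measure). For $\mu\in\mathcal{P}_{q,p}(\mathbb{R})$,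 $\delta_{\mathbf{x}}\times\mu$ is the product measure, viewed as an element of $\mathcal{P}_{q,p}(\mathbb{R}^{d+1})$, so $W_{q,p}(\delta_{\mathbf{x}}\times\mu,\delta_{\mathbf{y}}\times\nu)$ is the Wasserstein distance on $\mathbb{R}^{d+1}$ (with the $\ell_p$ norm of $\mathbb{R}^{d+1}$). For a probability measure $\mu$ on $\mathbb{R}$, $F_\mu$ is its cumulative distribution function and $F_\mu^{-1}(t)=\inf\{u:\ F_\mu(u)\geqslant t\}$. *)

(* Defs.v *)
From HB Require Import structures.
From mathcomp Require Import all_boot all_order all_algebra.
From mathcomp Require Import all_classical all_reals all_analysis.
From mathcomp Require Import measurable_realfun.

Set Implicit Arguments.
Unset Strict Implicit.
Unset Printing Implicit Defensive.

Import Order.TTheory GRing.Theory Num.Def Num.Theory.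
Import numFieldNormedType.Exports.

Local Open Scope classical_set_scope.
Local Open Scope ring_scope.

(* R^k is [k.-tuple R]; its canonical sigma-algebra is generated by the
   coordinate projections, which is the Borel sigma-algebra of R^k. *)

Section lp_space.
Context {R : realType}.

Definition lp_norm k (p : R) (u : k.-tuple R) : R :=
  (\sum_(i < k) `|tnth u i| `^ p) `^ p^-1.

Definition vsub k (u v : k.-tuple R) : k.-tuple R :=
  [tuple tnth u i - tnth v i | i < k].

End lp_space.

Section wasserstein.
Context {R : realType}.
Local Open Scope ereal_scope.

Definition Pqp k (q p : R) : set (probability (k.-tuple R) R) :=
  [set mu | \int[mu]_u (lp_norm p u `^ q)%:E < +oo].

(* The case k = 1, with R in place of 1.-tuple R. *)
Definition PqpR (q p : R) : set (probability R R) :=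
  [set mu | \int[mu]_u (lp_norm p [tuple u] `^ q)%:E < +oo].

Definition couplings k (mu nu : probability (k.-tuple R) R) :
    set (probability (k.-tuple R * k.-tuple R)%type R) :=
  [set pi | forall A, measurable A ->
    pushforward pi fst A = mu A /\ pushforward pi snd A = nu A].

(* Defined for all probability measures, with values in [0, +oo]; the moments
   of order q need not be finite. *)
Definition wasserstein k (q p : R) (mu nu : probability (k.-tuple R) R)
    : \bar R :=
  (ereal_inf [set \int[pi]_uv (lp_norm p (vsub uv.1 uv.2) `^ q)%:E
             | pi in couplings mu nu]) `^ q^-1.

End wasserstein.

Section dirac_prod.
Context {R : realType} (d : nat).

(* The identification of R^d x R with R^(d+1), along which product measures
   are pushed forward. *)
Definition append (z : d.-tuple R * R) : d.+1.-tuple R :=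
  [tuple of rcons z.1 z.2].

Lemma measurable_append : measurable_fun setT append.
Proof.
apply/measurable_fun_tnthP => i.
have [j|] := unliftP ord_max i => [->|->].
  rewrite (_ : _ \o _ = (fun t => tnth t j) \o fst); last first.
    apply/funext => -[u a]; rewrite /= !(tnth_nth 0) /= nth_rcons size_tuple.
    have jd : (j < d)%N by exact: ltn_ord j.
    have -> : bump d j = j by rewrite /bump leqNgt jd.
    by rewrite jd.
  by apply: measurableT_comp => //; exact: measurable_tnth.
rewrite (_ : _ \o _ = snd) //.
apply/funext => -[u a].
by rewrite /= (tnth_nth 0) /= nth_rcons size_tuple ltnn eqxx.
Qed.

HB.instance Definition _ :=
  isMeasurableFun.Build _ _ _ _ append measurable_append.

Definition dirac_prod (x : d.-tuple R) (mu : probability R R)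
    : probability (d.+1.-tuple R) R :=
  distribution (\d_x \x mu)%E append.

End dirac_prod.

Section finite_moment.
Context {R : realType}.
Local Open Scope ereal_scope.

Lemma measurable_lp_norm k (p : R) :
  measurable_fun setT (fun u : k.-tuple R => lp_norm p u).
Proof.
apply: (measurableT_comp (measurable_powR _)).
apply: measurable_sum => i.
apply: (measurableT_comp (measurable_powR _)).
apply: measurableT_comp => //; exact: measurable_tnth.
Qed.

Lemma lp_norm_append d (p : R) (x : d.-tuple R) (a : R) : (1 <= p)%R ->
  lp_norm p (append (x, a)) = ((lp_norm p x `^ p + `|a| `^ p) `^ p^-1)%R.
Proof.
move=> p1; have p0 : p != 0%R by rewrite gt_eqF// (lt_le_trans ltr01).
rewrite /lp_norm -powRrM mulVf// powRr1; last first.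
  by apply: sumr_ge0 => i _; exact: powR_ge0.
rewrite big_ord_recr/=; congr ((_ + _) `^ _)%R; last first.
  by rewrite (tnth_nth 0%R)/= nth_rcons size_tuple ltnn eqxx.
apply: eq_bigr => i _; rewrite !(tnth_nth 0%R)/= nth_rcons size_tuple.
by have -> : (i < d)%N by exact: ltn_ord i.
Qed.

Lemma lp_norm1 (p a : R) : (1 <= p)%R -> lp_norm p [tuple a] = `|a|%R.
Proof.
move=> p1; have p0 : p != 0%R by rewrite gt_eqF// (lt_le_trans ltr01).
by rewrite /lp_norm big_ord1 -powRrM mulfV// powRr1.
Qed.

(* [dirac_prod x mu] belongs to the domain of the Wasserstein distance. *)
Lemma dirac_prod_Pqp d (p q : R) (x : d.-tuple R) (mu : probability R R) :
  (1 <= p)%R -> (1 <= q)%R -> PqpR q p mu -> Pqp q p (dirac_prod x mu).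
Proof.
move=> p1 q1; rewrite /PqpR /Pqp /=.
have p0 : (0 < p)%R by rewrite (lt_le_trans ltr01).
have q0 : (0 < q)%R by rewrite (lt_le_trans ltr01).
have mN k : measurable_fun setT (fun u : k.-tuple R => (lp_norm p u `^ q)%:E).
  apply/measurable_EFinP; apply: (measurableT_comp (measurable_powR _)).
  exact: measurable_lp_norm.
have ma : measurable_fun setT (fun a : R => ((`|a| `^ q)%:E : \bar R)).
  apply/measurable_EFinP; apply: (measurableT_comp (measurable_powR _)).
  exact: normr_measurable.
under eq_integral do rewrite lp_norm1//.
move=> mu_fin.
have -> : \int[dirac_prod x mu]_u (lp_norm p u `^ q)%:E =
    \int[\d_x \x mu]_z (lp_norm p (append z) `^ q)%:E.
  by apply: ge0_integral_distribution (mN _) _ => y; rewrite lee_fin powR_ge0.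
pose f (z : d.-tuple R * R) := (lp_norm p (append z) `^ q)%:E.
have f0 z : 0 <= f z by rewrite lee_fin powR_ge0.
have mf : measurable_fun setT f.
  by apply: measurableT_comp (mN _) _; exact: measurable_append.
have -> : \int[\d_x \x mu]_z f z = \int[\d_x]_u fubini_F mu f u.
  exact: fubini_tonelli1.
rewrite integral_dirac//; last exact: measurable_fun_fubini_tonelli_F.
rewrite diracT mul1e /fubini_F/= /f.
pose C := (2 `^ (q / p))%R; pose A := (lp_norm p x `^ q)%R.
have mg : measurable_fun setT (fun a : R => A%:E + (`|a| `^ q)%:E).
  exact: emeasurable_funD (measurable_cst _) ma.
have g0 a : 0 <= (`|a| `^ q)%:E by rewrite lee_fin powR_ge0.
have A0 : 0 <= A%:E by rewrite lee_fin powR_ge0.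
have C0 : 0 <= C%:E by rewrite lee_fin powR_ge0.
apply: (@le_lt_trans _ _ (\int[mu]_a (C%:E * (A%:E + (`|a| `^ q)%:E)))).
  apply: ge0_le_integral; first exact: measurableT.
  - by move=> a _; rewrite lee_fin powR_ge0.
  - exact: measurableT_comp mf (pair1_measurable x).
  - exact: measurable_funeM mg.
  move=> a _; rewrite -EFinD -EFinM lee_fin lp_norm_append// -powRrM mulrC.
  have N0 : (0 <= lp_norm p x)%R by exact: powR_ge0.
  pose m := maxr (lp_norm p x) `|a|%R.
  have m0 : (0 <= m)%R by rewrite le_max N0.
  have mle : (lp_norm p x `^ p + `|a| `^ p <= 2 * m `^ p)%R.
    have Nm : (lp_norm p x <= m)%R by rewrite le_max lexx.
    have am : (`|a| <= m)%R by rewrite le_max lexx orbT.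
    rewrite mulr_natl mulr2n.
    by apply: lerD; apply: ge0_ler_powR; rewrite ?nnegrE// ltW.
  apply: (@le_trans _ _ ((2 * m `^ p) `^ (q / p))%R).
    apply: ge0_ler_powR => //; rewrite ?nnegrE.
    - by rewrite divr_ge0// ltW.
    - by rewrite addr_ge0// powR_ge0.
    - by rewrite mulr_ge0// powR_ge0.
  rewrite powRM// ?powR_ge0// -powRrM mulrCA mulfV ?gt_eqF// mulr1.
  rewrite ler_wpM2l ?powR_ge0// /m.
  by case: (leP (lp_norm p x) `|a|%R) => _; rewrite ?lerDl ?lerDr powR_ge0.
rewrite ge0_integralZl//; last by move=> a _; rewrite adde_ge0.
apply: lte_mul_pinfty => //.
have -> : \int[mu]_a (A%:E + (`|a| `^ q)%:E) =
    \int[mu]_a (cst A%:E) a + \int[mu]_a (`|a| `^ q)%:E.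
  by apply: ge0_integralD => //; exact: measurable_cst.
have -> : \int[mu]_a (cst A%:E) a = A%:E * mu setT by exact: integral_cst.
by rewrite probability_setT mule1 lte_add_pinfty// ltry.
Qed.
End finite_moment.

Section quantile.
Context {R : realType}.

Definition cdfm (mu : probability R R) (u : R) : \bar R := mu `]-oo, u]%classic.

(* [inf] is the infimum in R, with value 0 on empty and on unbounded-below
   sets; the set is nonempty and bounded below when 0 < t < 1. *)
Definition quantile (mu : probability R R) (t : R) : R :=
  inf [set u : R | (t%:E <= cdfm mu u)%E].

End quantile.

(* Main.v *)
From HB Require Import structures.
Require Import Defs.
From mathcomp Require Import all_boot all_order all_algebra.
From mathcomp Require Import all_classical all_reals all_analysis.
From mathcomp Require Import measurable_realfun ring lra.
Import Order.TTheory GRing.Theory Num.Def Num.Theory.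
Import numFieldNormedType.Exports.
Local Open Scope classical_set_scope.
Local Open Scope ring_scope.

(* Under any coupling of the two product measures, the first d coordinates are
   almost surely x and y, so the cost is f |a - b| with
   f t = (|| x - y ||_p^p + t^p)^(q/p), and (a, b) couples mu and nu.  It
   remains to see that the quantile coupling minimizes the expectation of
   f |a - b|.

   By Tonelli, E (a - b - s)^+ is the integral over u of P(b + s <= u < a),
   which is at least (F_nu(u - s) - F_mu(u))^+, with equality for the quantile
   coupling; so the latter is optimal for the costs (|a - b| - s)^+, s >= 0.
   As f is nondecreasing and convex on [0, +oo[ (Minkowski), it is the limit of
   functions below it of the form f 0 + sum_j w_j (t - s_j)^+ with w_j >= 0,
   and Fatou's lemma gives optimality for f. *)

(** * Approximation of convex functions by hinges *)

Section hinge.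
Context {R : realType}.

(** The entry at 0 is the initial slope and the later ones are changes of slope, so that partial
    sums telescope to single slopes. *)
Definition second_diff (D : nat -> R) j :=
  if j is i.+1 then D i.+2 - 2 * D i.+1 + D i else D 1%N - D 0%N.

Lemma sum_second_diff D k : \sum_(j < k.+1) second_diff D j = D k.+1 - D k.
Proof.
elim: k => [|k IH]; first by rewrite big_ord1.
by rewrite big_ord_recr/= IH /=; ring.
Qed.

(** Discrete Taylor formula: raising [k] by one adds the weights of index at most [k], which sum to
    the next increment of [D]. *)
Lemma sum_hinge_nat D N k : (k <= N)%N ->
  \sum_(j < N) second_diff D j * maxr 0 (k%:R - j%:R) = D k - D 0%N.
Proof.
elim: k => [_|k IH kN].
  by rewrite subrr big1// => j _; rewrite sub0r max_l ?mulr0//.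
have -> : D k.+1 - D 0%N = (D k - D 0%N) + (D k.+1 - D k) by ring.
rewrite -IH ?(ltnW kN)// -sum_second_diff (big_ord_widen N (second_diff D))//.
rewrite [X in _ = _ + X]big_mkcond -big_split/=.
apply: eq_bigr => j _; rewrite ltnS; case: ifPn => jk.
  rewrite !max_r ?subr_ge0 ?ler_nat ?(leq_trans jk)//.
  by rewrite -natr1; ring.
rewrite -ltnNge in jk.
by rewrite !max_l ?subr_le0 ?ler_nat ?(ltnW jk)// mulr0 addr0.
Qed.

(* The piecewise linear interpolation of f with mesh 1/(n+1), truncated to
   finitely many slopes; the kinks are shifted right by one mesh (j+1 instead of
   j) so that the result lies below f. *)
Definition hinge_approx (f : R -> R) n (t : R) :=
  f 0 + \sum_(j < n.+1 * n.+1)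
    second_diff (fun k => f (k%:R / n.+1%:R)) j
      * (n.+1%:R * maxr 0 (t - j.+1%:R / n.+1%:R)).

Variable f : R -> R.
Hypothesis f_nd : forall s t : R, 0 <= s -> s <= t -> f s <= f t.
Hypothesis f_cvx : forall l s t : R, 0 <= l <= 1 -> 0 <= s -> 0 <= t ->
  f (l * s + (1 - l) * t) <= l * f s + (1 - l) * f t.

(** Monotonicity handles the initial slope, midpoint convexity the changes of slope. *)
Lemma second_diff_ge0 n j : 0 <= second_diff (fun k => f (k%:R / n.+1%:R)) j.
Proof.
case: j => [|j] /=; first by rewrite subr_ge0 f_nd// mul0r.
have := @f_cvx 2^-1 (j.+2%:R / n.+1%:R) (j%:R / n.+1%:R).
have -> : 2^-1 * (j.+2%:R / n.+1%:R) + (1 - 2^-1) * (j%:R / n.+1%:R) =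
    j.+1%:R / n.+1%:R :> R.
  have : n.+1%:R != 0 :> R by rewrite pnatr_eq0.
  move: (n.+1%:R) => a a0.
  by rewrite -(natr1 j.+1) -(natr1 j); field.
have i1 : (0 : R) <= 2^-1 <= (1 : R).
  by rewrite invr_ge0 ler0n/= invf_le1 ?ltr0n ?ler1n.
by move=> /(_ i1 (divr_ge0 _ _) (divr_ge0 _ _)); rewrite !ler0n
  => /(_ isT isT isT isT) ?; lra.
Qed.

(** Let [a = n + 1] and let [k] be the integer part of [t * a]. Since [t * a - (j + 1) <= k - j],
    each shifted hinge at [t] is at most the unshifted one at [k / a]; the unshifted ones
    interpolate [f] there, and [f (k / a) <= f t]. *)
Lemma hinge_approx_le n t : 0 <= t -> hinge_approx f n t <= f t.
Proof.
move=> t0; set a : R := n.+1%:R; have a0 : 0 < a by rewrite ltr0n.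
pose k := Num.truncn (t * a).
have /andP[kt tk] : k%:R <= t * a < k.+1%:R
  by apply: truncn_itv; rewrite mulr_ge0// ltW.
pose D k := f (k%:R / a).
apply: (@le_trans _ _ (D k)); last first.
  by apply: f_nd; [rewrite divr_ge0// ltW|rewrite ler_pdivrMr].
(* The interpolation formula requires at least [k] terms, possibly more than the truncation keeps;
   the added ones are nonnegative. *)
pose N := maxn (n.+1 * n.+1) k.
have -> : D k = f 0 + (D k - D 0%N) by rewrite /D mul0r; ring.
rewrite -(@sum_hinge_nat D N k) ?leq_maxr// /hinge_approx lerD2l.
apply: (@le_trans _ _
    (\sum_(j < n.+1 * n.+1) second_diff D j * maxr 0 (k%:R - j%:R))).
  apply: ler_sum => j _; apply: ler_wpM2l; first exact: second_diff_ge0.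
  rewrite -/a maxr_pMr ?(ltW a0)// mulr0 mulrBr mulrCA divff ?gt_eqF// mulr1.
  rewrite ge_max le_max lexx/= le_max; apply/orP; right.
  by rewrite -natr1 in tk; rewrite -natr1; lra.
rewrite (big_ord_widen N
  (fun j => second_diff D j * maxr 0 (k%:R - j%:R))) ?leq_maxl//.
rewrite big_mkcond/=; apply: ler_sum => j _; case: ifPn => // _.
by rewrite mulr_ge0 ?second_diff_ge0// le_max lexx.
Qed.

Lemma hinge_approx_ge0 n t : 0 <= t -> f 0 <= hinge_approx f n t.
Proof.
move=> t0; rewrite /hinge_approx lerDl sumr_ge0// => j _.
by rewrite mulr_ge0 ?second_diff_ge0// mulr_ge0// le_max lexx.
Qed.

(** One mesh is lost in rounding [t] down to the grid, another in the shift of the kinks. The bound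
    [t <= n + 1] ensures that the truncation keeps every hinge that is positive at [t]. *)
Lemma hinge_approx_ge n t : 0 <= t -> t <= n.+1%:R ->
  f (maxr 0 (t - 2 / n.+1%:R)) <= hinge_approx f n t.
Proof.
move=> t0; set a : R := n.+1%:R => ta; have a0 : 0 < a by rewrite ltr0n.
pose k := Num.truncn (t * a).
have /andP[kt tk] : k%:R <= t * a < k.+1%:R
  by apply: truncn_itv; rewrite mulr_ge0// ltW.
have kN : (k <= n.+1 * n.+1)%N.
  rewrite -(ler_nat R) natrM (le_trans kt)// ler_wpM2r// ltW//.
pose D k := f (k%:R / a).
(* From here [k] is one less than the integer part of [t * a], which absorbs the shift; if the
   integer part is 0, the left side is [f 0]. *)
case: k kt tk kN => [|k] kt tk kN.
  rewrite max_l ?hinge_approx_ge0// subr_le0 ler_pdivlMr//; lra.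
apply: (@le_trans _ _ (D k)).
  apply: f_nd; first by rewrite le_max lexx.
  rewrite ge_max divr_ge0 ?(ltW a0)//= lerBlDr -mulrDl ler_pdivlMr//.
  by rewrite -(natr1 k.+1) -(natr1 k) in tk; lra.
have -> : D k = f 0 + (D k - D 0%N) by rewrite /D mul0r; ring.
rewrite -(@sum_hinge_nat D (n.+1 * n.+1) k) ?(ltnW kN)// lerD2l.
apply: ler_sum => j _; apply: ler_wpM2l; first exact: second_diff_ge0.
rewrite -/a maxr_pMr ?(ltW a0)// mulr0 mulrBr mulrCA divff ?gt_eqF// mulr1.
rewrite ge_max le_max lexx/= le_max; apply/orP; right.
by rewrite -(natr1 k) in kt; rewrite -natr1; lra.
Qed.

Hypothesis f_ge0 : forall t, 0 <= t -> 0 <= f t.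

Lemma cvg_hinge_approx t : 0 <= t ->
  hinge_approx f n t @[n --> \oo] --> f t.
Proof.
move=> t0.
(* At 0 every approximation equals [f 0]; the estimate for the other points divides by [t]. *)
have [->|tn0] := eqVneq t 0.
  apply: (@cvg_near_cst _ _ _ _ eventually); apply: nearW => n.
  apply/eqP; rewrite eq_le hinge_approx_le//=; exact: hinge_approx_ge0.
have {tn0}t_gt0 : 0 < t by rewrite lt_neqAle eq_sym tn0.
(* With [d = 2 / (n + 1)], the error term is [d / t * f (2 * t)], which convexity between [t - d]
   and [2 * t] shows to bound [f t - f (t - d)]. *)
apply: (@squeeze_cvgr _ _ _ _ (fun n => f t - 2 * f (2 * t) / t * n.+1%:R^-1)
  (fun=> f t)); last first.
- exact: cvg_cst.
- rewrite -[X in _ --> X]subr0; apply: cvgB; first exact: cvg_cst.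
  rewrite -(mulr0 (2 * f (2 * t) / t)); apply: cvgMr.
  exact: cvg_harmonic.
near=> n; rewrite hinge_approx_le// andbT.
have a0 : 0 < n.+1%:R :> R by [].
have ta : t <= n.+1%:R.
  apply: (@le_trans _ _ n%:R); last by rewrite ler_nat.
  near: n; exact: nbhs_infty_ger.
have hat : 2 / t <= n.+1%:R.
  apply: (@le_trans _ _ n%:R); last by rewrite ler_nat.
  near: n; exact: nbhs_infty_ger.
have := @hinge_approx_ge n t t0 ta; apply: le_trans.
set d := 2 / n.+1%:R.
have dt : d <= t by rewrite /d ler_pdivrMr// mulrC -ler_pdivrMr.
have d0 : 0 < d by rewrite divr_gt0.
rewrite max_r ?subr_ge0//.
(* Left continuity at t, from the convexity of f on t - d < t < 2 t. *)
have := @f_cvx (t / (t + d)) (t - d) (2 * t).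
have -> : t / (t + d) * (t - d) + (1 - t / (t + d)) * (2 * t) = t.
  by field; rewrite gt_eqF// addr_gt0.
have -> : 1 - t / (t + d) = d / (t + d) by field; rewrite gt_eqF// addr_gt0.
move=> H.
have td0 : 0 < t + d by exact: addr_gt0.
have l01 : 0 <= t / (t + d) <= 1.
  by rewrite divr_ge0 ?(ltW td0)//= ler_pdivrMr// mul1r lerDl ltW.
have {H} H := H l01 ltac:(by rewrite subr_ge0) ltac:(by rewrite mulr_ge0).
have -> : 2 * f (2 * t) / t / n.+1%:R = d / t * f (2 * t).
  by rewrite /d; ring.
have f1 : 0 <= f (t - d) by rewrite f_ge0// subr_ge0.
have f2 : 0 <= f (2 * t) by rewrite f_ge0// mulr_ge0.
have : t / (t + d) * f (t - d) <= f (t - d).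
  by rewrite ler_piMl// ler_pdivrMr ?addr_gt0// mul1r lerDl ltW.
have : d / (t + d) * f (2 * t) <= d / t * f (2 * t).
  by rewrite ler_wpM2r// ler_wpM2l ?(ltW d0)// lef_pV2 ?posrE// lerDl ltW.
lra.
Unshelve. all: by end_near. Qed.

End hinge.

(** * Layer-cake formula and quantiles *)

Section layer_cake.
Context d (T : measurableType d) {R : realType} (P : probability T R).
Variables (X Y : T -> R).
Hypotheses (mX : measurable_fun setT X) (mY : measurable_fun setT Y).
Local Open Scope ereal_scope.

(** The product measure of this region, computed by sections in either order, yields the two sides
    of [integral_hinge]. *)
Let S s : set (T * measurableTypeR R) :=
  [set z | (Y z.1 + s <= z.2 < X z.1)%R].

Let mS s : measurable (S s).
Proof.
rewrite (_ : S s =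
  (fun z => (Y z.1 + s <= z.2)%R && (z.2 < X z.1)%R) @^-1` [set true])//.
have m1 : measurable_fun setT (fun z : T * measurableTypeR R => X z.1).
  exact: measurableT_comp.
have m2 : measurable_fun setT (fun z : T * measurableTypeR R => Y z.1).
  exact: measurableT_comp.
have m3 : measurable_fun setT (fun z : T * measurableTypeR R => z.2 : R).
  exact: measurable_snd.
rewrite -[X in measurable X]setTI.
suff mb : measurable_fun setT (fun z => (Y z.1 + s <= z.2)%R && (z.2 < X z.1)%R).
  exact: mb.
apply: measurable_and => //.
  by apply: measurable_fun_ler => //; exact: measurable_funD.
exact: measurable_fun_ltr.
Qed.

Let ysectionS s u : ysection (S s) u = [set w | (Y w + s <= u < X w)%R].
Proof. by apply/seteqP; split => w; rewrite /ysection/= inE. Qed.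

Lemma measurable_gap s u : measurable [set w | (Y w + s <= u < X w)%R].
Proof. by rewrite -ysectionS; exact: measurable_ysection. Qed.

Lemma measurable_prob_gap s : measurable_fun (setT : set (measurableTypeR R))
  (fun u => P [set w | (Y w + s <= u < X w)%R]).
Proof.
by under eq_fun do rewrite -ysectionS; exact: measurable_fun_ysection.
Qed.

Lemma integral_hinge s :
  \int[P]_w (maxr 0 (X w - Y w - s))%:E =
  \int[lebesgue_measure]_u P [set w | (Y w + s <= u < X w)%R].
Proof.
pose f z := (\1_(S s) z)%:E : \bar R.
have mf : measurable_fun setT f.
  by apply/measurable_EFinP; exact: measurable_indic.
have f0 z : 0 <= f z by rewrite lee_fin.
have := @fubini_tonelli _ _ T (measurableTypeR R) R P lebesgue_measure f mf f0.
have fE w : \int[lebesgue_measure]_u f (w, u) = (maxr 0 (X w - Y w - s))%:E.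
  transitivity (\int[lebesgue_measure]_u (\1_(`[(Y w + s)%R, X w[) u)%:E : \bar R).
    apply: eq_integral => u _; rewrite /f !indicE; congr ((nat_of_bool _)%:R%:E).
  rewrite integral_indic//.
  rewrite setIT/= lebesgue_measure_itv/= lte_fin -EFinB.
  case: ltP => h; congr EFin.
    by rewrite max_r; [ring|lra].
  by rewrite max_l//; lra.
have fE' u : \int[P]_w f (w, u) = P [set w | (Y w + s <= u < X w)%R].
  transitivity (\int[P]_w (\1_(ysection (S s) u) w)%:E : \bar R).
    apply: eq_integral => w _; rewrite /f !indicE; congr ((nat_of_bool _)%:R%:E).
    by rewrite mem_ysection.
  rewrite integral_indic//; last exact: measurable_ysection.
  by rewrite setIT ysectionS.
by under eq_integral do rewrite fE; under [in RHS]eq_integral do rewrite fE'.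
Qed.

End layer_cake.

(** * Galois connection between quantile and distribution functions *)

Section quantile_function.
Context {R : realType} (mu : probability R R).
Local Open Scope ereal_scope.

(** As a random variable under [mu], the identity has [cdfm mu] as its distribution function, so
    that the limits and the right continuity of [cdf] apply. *)
Let idR : R -> R := idfun.
#[local] HB.instance Definition _ :=
  @isMeasurableFun.Build _ _ R R idR (@measurable_id _ _ setT).
Let X : {RV mu >-> R} := idR.

Let cdfE u : cdfm mu u = cdf X u. Proof. by []. Qed.

(** The set defining the quantile is a closed upward ray: for [0 < t < 1] the limits of the
    distribution function make it nonempty and bounded below, and right continuity puts its infimum
    in it. *)
Lemma quantile_le (t u : R) : (0 < t < 1)%R ->
  (quantile mu t <= u)%R = (t%:E <= cdfm mu u).
Proof.
move=> /andP[t0 t1]; pose A := [set v : R | t%:E <= cdfm mu v].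
have Aup v w : A v -> (v <= w)%R -> A w.
  move=> Av vw; apply: (le_trans Av); rewrite !cdfE; exact: cdf_nondecreasing.
have A0 : A !=set0.
  have /filter_ex[v /ltW tv] : \forall v \near +oo%R, t%:E < cdf X v.
    by apply: (@cvg_cdfy1 _ _ _ mu X (fun y => t%:E < y));
    apply: open_ereal_gt'; rewrite lte_fin.
  by exists v.
have Alb : has_lbound A.
  have /filter_ex[v vt] : \forall v \near -oo%R, cdf X v < t%:E.
    by apply: (@cvg_cdfNy0 _ _ _ mu X (fun y => y < t%:E));
    apply: open_ereal_lt'; rewrite lte_fin.
  exists v => w Aw; rewrite leNgt.
  apply/negP => /ltW wv; have := Aup _ _ Aw wv.
  by rewrite /A/= leNgt cdfE vt.
have Aq : A (quantile mu t).
  have cX := @cdf_right_continuous _ _ _ _ X (quantile mu t).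
  apply: (cvge_ge _ cX).
  near=> v; have /(inf_lt A0)[w Aw wv] : (inf A < v)%R.
    by near: v; exact: nbhs_right_gt.
  by apply: Aup Aw _; exact: ltW.
apply/idP/idP => [qu|tu]; first exact: Aup Aq qu.
exact: ge_inf.
Unshelve. all: by end_near. Qed.

(* Set to 0 off ]0, 1[, where [quantile] may take junk values. *)
Definition quantile01 (t : measurableTypeR R) : R :=
  if (0 < t)%R && (t < 1)%R then quantile mu t else 0%R.

Lemma quantile01E t : t \in `]0%R, 1%R[ -> quantile01 t = quantile mu t.
Proof. by rewrite in_itv/= /quantile01 => ->. Qed.

Lemma cdfm_fin u : cdfm mu u = (fine (cdfm mu u))%:E.
Proof. by rewrite fineK// fin_num_measure. Qed.

Lemma quantile01_le t u : t \in `]0%R, 1%R[ ->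
  (quantile01 t <= u)%R = (t <= fine (cdfm mu u))%R.
Proof.
by move=> t01; rewrite quantile01E// quantile_le -?lee_fin -?cdfm_fin.
Qed.

Lemma measurable_quantile01 : measurable_fun setT quantile01.
Proof.
apply: measurable_fun_if => //.
  by apply: measurable_and => //; exact: measurable_fun_ltr.
rewrite setTI (_ : _ @^-1` _ = `]0%R, 1%R[%classic); last first.
  by apply/seteqP; split => t /=; rewrite in_itv.
apply: (measurability (@RGenOInfty.G R)).
  exact: RGenOInfty.measurableE.
move=> /= _ [_ [u ->] <-].
(* By the Galois connection, the quantile at [t] exceeds [u] exactly when [t] exceeds the
   distribution function at [u]. *)
rewrite (_ : _ `&` _ = `]0%R, 1%R[ `&` `]fine (cdfm mu u), +oo[).
  by apply: measurableI; exact: measurable_itv.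
apply/seteqP; split => t [t01] /=; rewrite !in_itv/= !andbT => h; split => //.
  by rewrite ltNge -quantile01_le// quantile01E// -ltNge.
by rewrite -quantile01E// ltNge quantile01_le// -ltNge.
Qed.

HB.instance Definition _ :=
  isMeasurableFun.Build _ _ (measurableTypeR R) R quantile01 measurable_quantile01.

End quantile_function.

(** * Uniform law and inverse transform sampling *)

Section uniform01.
Context {R : realType}.
Local Open Scope ereal_scope.
Local Notation P0 := (uniform_prob (@ltr01 R)).

Lemma integral_uniform01 (f : measurableTypeR R -> \bar R) :
  measurable_fun setT f -> (forall x, 0 <= f x) ->
  \int[P0]_x f x = \int[lebesgue_measure]_(x in `]0%R, 1%R[) f x.
Proof.
move=> mf f0; rewrite integral_uniform// subr0 invr1 mul1e.
by rewrite integral_itv_bndoo//; exact: measurable_funTS.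
Qed.

Lemma uniform_prob01E (A : set (measurableTypeR R)) : measurable A ->
  P0 A = lebesgue_measure (A `&` `]0%R, 1%R[).
Proof.
move=> mA; transitivity (\int[P0]_x (\1_A x)%:E).
  by rewrite integral_indic// setIT.
rewrite integral_uniform01//; first by rewrite integral_indic.
by apply/measurable_EFinP; exact: measurable_indic.
Qed.

(** Within ]0, 1[ the event consists of the [t] up to the value of the distribution function at [u],
    so its length is that value. *)
Lemma quantile01_cdf (mu : probability R R) u :
  P0 [set t | (quantile01 mu t <= u)%R] = cdfm mu u.
Proof.
have F1 : (fine (cdfm mu u) <= 1)%R.
  by rewrite -lee_fin -cdfm_fin; exact: probability_le1.
have F0 : (0 <= fine (cdfm mu u))%R by rewrite fine_ge0.
pose B : set (measurableTypeR R) := `]0%R, fine (cdfm mu u)]%classic.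
have mB : measurable B by exact: measurable_itv.
transitivity (P0 B).
  rewrite !uniform_prob01E//; last first.
    rewrite (_ : [set _ | _] = quantile01 mu @^-1` `]-oo, u]%classic); last first.
      by apply/seteqP; split => t/=; rewrite in_itv.
    by rewrite -[X in measurable X]setTI; exact: measurable_quantile01.
  congr lebesgue_measure; apply/seteqP.
  split => t [/= + t01]; rewrite /B/= in_itv/= quantile01_le// => h; split => //.
    by move: t01; rewrite /= in_itv/= h andbT => /andP[].
  by case/andP : h.
transitivity (lebesgue_measure B); last first.
  rewrite lebesgue_measure_itv/= lte_fin [RHS]cdfm_fin sube0.
  by case: ltP => // h; congr EFin; apply/eqP; rewrite eq_le h F0.
(* [B] contains 1 when the distribution function reaches 1 at [u]; hence the comparison with the
   closed unit interval. *)
have BI : B `&` `[0%R, 1%R]%classic = B.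
  apply/setIidl => t; rewrite /B/= !in_itv/= => /andP[t0 tF].
  by rewrite ltW//= (le_trans tF).
transitivity (\int[P0]_x (\1_B x)%:E); first by rewrite integral_indic// setIT.
rewrite integral_uniform//; last first.
  by apply/measurable_EFinP; exact: measurable_indic.
by rewrite subr0 invr1 mul1e integral_indic// BI.
Qed.

(** Finite measures that agree on the rays []x, +oo[], a generating family closed under
    intersection, are equal; agreement on the complementary rays is [quantile01_cdf]. *)
Lemma distribution_quantile01 (mu : probability R R) (A : set R) :
  measurable A -> P0 (quantile01 mu @^-1` A) = mu A.
Proof.
move=> mA; rewrite -[LHS]/(distribution P0 (quantile01 mu) A).
apply: (measure_unique (@RGenOInfty.G R) (fun k => `](- k%:R)%R, +oo[%classic)) => //.
- exact: RGenOInfty.measurableE.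
- move=> _ _ [x ->] [y ->]; exists (maxr x y).
  apply/seteqP; split => t /=; rewrite !in_itv/= !andbT gt_max; first by case=> -> ->.
  by move=> /andP.
- by move=> k; exists (- k%:R)%R.
- rewrite -subTset => t _; exists (Num.bound `|t|) => //=.
  by rewrite in_itv/= andbT ltrNl (le_lt_trans (ler_norm _))// normrN archi_boundP.
- move=> _ [x ->]; rewrite -setCitvl.
  have m1 := @measurable_itv R `]-oo, x].
  transitivity (1 - distribution P0 (quantile01 mu) `]-oo, x]).
    exact: probability_setC.
  transitivity (1 - mu `]-oo, x]%classic); last exact/esym/probability_setC.
  congr (_ - _); rewrite -[RHS]/(cdfm mu x) -quantile01_cdf.
  by congr (uniform_prob _ _).
- by move=> k; rewrite (le_lt_trans (probability_le1 _ _)) ?ltry.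
Qed.

(** Within ]0, 1[ the event lies between two values of distribution functions, by the Galois
    connection. With [prob_gap_ge], this makes the quantile coupling optimal at each level [u]. *)
Lemma uniform_prob_gap_le (mu nu : probability R R) s u :
  P0 [set t | (quantile01 nu t + s <= u < quantile01 mu t)%R] <=
  maxe 0 (cdfm nu (u - s) - cdfm mu u).
Proof.
set S := [set t | _].
have mS : measurable S.
  by apply: measurable_gap; exact: measurable_quantile01.
rewrite uniform_prob01E//.
apply: (@le_trans _ _ (lebesgue_measure
    (`]fine (cdfm mu u), fine (cdfm nu (u - s))]%classic : set (measurableTypeR R)))).
  apply: le_measure; rewrite ?inE//; first exact: measurableI.
  move=> t [/= /andP[h1 h2] t01]; rewrite in_itv/= -quantile01_le// lerBrDr h1 andbT.
  by rewrite ltNge -quantile01_le// -ltNge.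
rewrite lebesgue_measure_itv/= lte_fin -EFinB (cdfm_fin mu) (cdfm_fin nu)/=.
by rewrite -EFinB; case: ifP => h; rewrite le_max lexx ?orbT.
Qed.

End uniform01.

(** * Optimality of the quantile coupling on the line *)

Section integral_hinge_approx.
Context d (T : measurableType d) {R : realType} (P : probability T R).
Variables (X Y : T -> R).
Hypotheses (mX : measurable_fun setT X) (mY : measurable_fun setT Y).
Local Open Scope ereal_scope.

Lemma measurable_hinge s : measurable_fun setT (fun w => maxr 0%R (X w - Y w - s)%R).
Proof.
apply: (@measurable_maxr _ _ _ setT (cst 0%R)
  (fun w => (X w - Y w - s)%R)) => //.
by apply: measurable_funB => //; exact: measurable_funB.
Qed.

Lemma measurable_abs_hinge s :
  measurable_fun setT (fun w => maxr 0%R (`|X w - Y w| - s)%R).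
Proof.
apply: (@measurable_maxr _ _ _ setT (cst 0%R)
  (fun w => (`|X w - Y w| - s)%R)) => //.
apply: measurable_funB => //; apply: measurableT_comp => //.
exact: measurable_funB.
Qed.

(** Nonnegative weights let sums and constants leave the integral even when its value is
    infinite. *)
Lemma integral_hinge_approx (f : R -> R) n : (0 <= f 0%R)%R ->
  (forall j, 0 <= second_diff (fun k => f (k%:R / n.+1%:R)) j)%R ->
  \int[P]_w (hinge_approx f n `|X w - Y w|)%:E =
  (f 0%R)%:E + \sum_(j < n.+1 * n.+1)
     (second_diff (fun k => f (k%:R / n.+1%:R)) j * n.+1%:R)%:E *
     \int[P]_w (maxr 0%R (`|X w - Y w| - j.+1%:R / n.+1%:R)%R)%:E.
Proof.
move=> f0 sd0; rewrite /hinge_approx.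
have mterm (j : nat) c : measurable_fun setT
    (fun w => (c * maxr 0%R (`|X w - Y w| - j.+1%:R / n.+1%:R))%R%:E : \bar R).
  apply/measurable_EFinP; apply: measurable_funM => //.
  exact: measurable_abs_hinge.
under eq_integral => w _.
  rewrite EFinD -sumEFin; under eq_bigr do rewrite mulrA; over.
have sn0 (j : nat) : (0 <= second_diff (fun k => f (k%:R / n.+1%:R)) j * n.+1%:R)%R.
  by rewrite mulr_ge0.
have m0 (a : R) : (0 <= maxr 0 a)%R by rewrite le_max lexx.
rewrite ge0_integralD//=; last 2 first.
- by move=> w _; rewrite sume_ge0// => j _; rewrite lee_fin mulr_ge0.
- exact: emeasurable_sum.
have -> : \int[P]_w (f 0%R)%:E = (f 0%R)%:E * P setT by exact: integral_cst.
rewrite probability_setT mule1; congr (_ + _).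
rewrite ge0_integral_sum//; last by move=> j w _; rewrite lee_fin mulr_ge0.
apply: eq_bigr => j _; under eq_integral do rewrite EFinM.
rewrite ge0_integralZl_EFin//.
by apply/measurable_EFinP; exact: measurable_abs_hinge.
Qed.

(** Reduces absolute costs to one-sided hinges: as [0 <= s], at most one of the two is nonzero at
    each point. *)
Lemma integral_abs_hinge s : (0 <= s)%R ->
  \int[P]_w (maxr 0%R (`|X w - Y w| - s)%R)%:E =
  \int[P]_w (maxr 0%R (X w - Y w - s)%R)%:E +
  \int[P]_w (maxr 0%R (Y w - X w - s)%R)%:E.
Proof.
move=> s0; rewrite -ge0_integralD//=.
- apply: eq_integral => w _; rewrite -EFinD; congr EFin.
  have [h|h] := leP 0%R (X w - Y w)%R.
    have -> : maxr 0%R (Y w - X w - s)%R = 0%R by rewrite max_l//; lra.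
    by rewrite ger0_norm// addr0.
  have -> : maxr 0%R (X w - Y w - s)%R = 0%R by rewrite max_l//; lra.
  by rewrite ltr0_norm// opprB add0r.
- by move=> w _; rewrite lee_fin le_max lexx.
- by apply/measurable_EFinP; exact: measurable_hinge.
- by move=> w _; rewrite lee_fin le_max lexx.
- apply/measurable_EFinP.
  apply: (@measurable_maxr _ _ _ setT (cst 0%R)
    (fun w => (Y w - X w - s)%R)) => //.
  by apply: measurable_funB => //; exact: measurable_funB.
Qed.

End integral_hinge_approx.

Section hinge_comparison.
Context d (T : measurableType d) {R : realType} (P : probability T R).
Local Open Scope ereal_scope.
Local Notation P0 := (uniform_prob (@ltr01 R)).

(** Union bound: when [Y <= u - s], either [X <= u] or the gap event occurs. *)
Lemma prob_gap_ge (X Y : T -> R) (mu nu : probability R R) s u :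
  measurable_fun setT X -> measurable_fun setT Y ->
  (forall u, P [set w | (X w <= u)%R] = cdfm mu u) ->
  (forall u, P [set w | (Y w <= u)%R] = cdfm nu u) ->
  maxe 0 (cdfm nu (u - s) - cdfm mu u) <=
  P [set w | (Y w + s <= u < X w)%R].
Proof.
move=> mX mY hX hY; rewrite ge_max measure_ge0/= leeBlDr ?fin_num_measure//.
rewrite -hX -hY.
have mle (Z : T -> R) v : measurable_fun setT Z -> measurable [set w | (Z w <= v)%R].
  move=> mZ; rewrite (_ : [set _ | _] = Z @^-1` `]-oo, v]%classic); last first.
    by apply/seteqP; split => t/=; rewrite in_itv.
  by rewrite -[X in measurable X]setTI; exact: mZ.
apply: (le_trans _ (measureU2 _ _ _)); [|exact: measurable_gap|exact: mle].
apply: le_measure; rewrite ?inE; [exact: mle| |].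
  by apply: measurableU; [exact: measurable_gap|exact: mle].
move=> w/= Yw; case: (leP (X w) u) => Xu; [by right|left].
by rewrite -lerBrDr Yw.
Qed.

Lemma integral_hinge_le (X Y : T -> R) (mu nu : probability R R) s :
  measurable_fun setT X -> measurable_fun setT Y ->
  (forall u, P [set w | (X w <= u)%R] = cdfm mu u) ->
  (forall u, P [set w | (Y w <= u)%R] = cdfm nu u) ->
  \int[P0]_t (maxr 0%R (quantile01 mu t - quantile01 nu t - s)%R)%:E <=
  \int[P]_w (maxr 0%R (X w - Y w - s)%R)%:E.
Proof.
move=> mX mY hX hY.
have mq m := @measurable_quantile01 R m.
rewrite !integral_hinge//.
apply: ge0_le_integral => //.
- by apply: measurable_prob_gap.
- exact: measurable_prob_gap.
move=> u _; apply: le_trans (uniform_prob_gap_le _ _ _ _) _.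
exact: prob_gap_ge.
Qed.

Context {X Y : T -> R} {mu nu : probability R R}.
Hypotheses (mX : measurable_fun setT X) (mY : measurable_fun setT Y).
Hypothesis hX : forall u, P [set w | (X w <= u)%R] = cdfm mu u.
Hypothesis hY : forall u, P [set w | (Y w <= u)%R] = cdfm nu u.
Context (f : R -> R).
Hypothesis f_nd : forall s t : R, (0 <= s -> s <= t -> f s <= f t)%R.
Hypothesis f_cvx : forall l s t : R, (0 <= l <= 1 -> 0 <= s -> 0 <= t ->
  f (l * s + (1 - l) * t) <= l * f s + (1 - l) * f t)%R.
Hypothesis f_ge0 : forall t : R, (0 <= t -> 0 <= f t)%R.
Hypothesis mf : measurable_fun setT f.

Let mq m := @measurable_quantile01 R m.

(** The hinges are compared one by one under nonnegative weights; then [hinge_approx f n] is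
    replaced by the larger [f] on the side of the arbitrary coupling. *)
Lemma integral_hinge_approx_le n :
  \int[P0]_t (hinge_approx f n `|quantile01 mu t - quantile01 nu t|)%:E <=
  \int[P]_w (f `|X w - Y w|)%:E.
Proof.
have m0 (a : R) : (0 <= maxr 0 a)%R by rewrite le_max lexx.
apply: (@le_trans _ _ (\int[P]_w (hinge_approx f n `|X w - Y w|)%:E)).
  have sd0 := second_diff_ge0 f f_nd f_cvx n.
  rewrite !integral_hinge_approx ?f_ge0//.
  rewrite leeD2l// lee_sum// => j _; rewrite lee_wpmul2l ?lee_fin ?mulr_ge0//.
  rewrite !integral_abs_hinge//.
  by apply: leeD; exact: integral_hinge_le.
apply: ge0_le_integral => //.
- move=> w _; rewrite lee_fin (le_trans (f_ge0 _ (lexx 0%R)))//.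
  exact: hinge_approx_ge0.
- apply/measurable_EFinP/measurable_funD => //.
  apply: measurable_sum => j; apply: measurable_funM => //.
  apply: measurable_funM => //; exact: measurable_abs_hinge.
- apply/measurable_EFinP; apply: measurableT_comp => //.
  by apply: measurableT_comp => //; exact: measurable_funB.
- by move=> w _; rewrite lee_fin hinge_approx_le.
Qed.

(** The limit in [n] is taken on the quantile side alone, the other side being a bound independent
    of [n]. *)
Lemma quantile_coupling_le :
  \int[P0]_t (f `|quantile01 mu t - quantile01 nu t|)%:E <=
  \int[P]_w (f `|X w - Y w|)%:E.
Proof.
pose g n (t : measurableTypeR R) :=
  (hinge_approx f n `|quantile01 mu t - quantile01 nu t|)%:E : \bar R.
have mg n : measurable_fun setT (g n).
  apply/measurable_EFinP/measurable_funD => //.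
  apply: measurable_sum => j; apply: measurable_funM => //.
  by apply: measurable_funM => //; apply: measurable_abs_hinge.
have g0 n t : [set: measurableTypeR R] t -> 0 <= g n t.
  move=> _; rewrite lee_fin (le_trans (f_ge0 _ (lexx 0%R)))//.
  exact: hinge_approx_ge0.
have := fatou P0 measurableT mg g0.
rewrite (_ : \int[P0]_(x in setT) limn_einf (g ^~ x) =
    \int[P0]_t (f `|quantile01 mu t - quantile01 nu t|)%:E); last first.
  apply: eq_integral => t _; apply: (cvg_limn_einf_sup _).1.
  apply/cvg_EFin; first exact: nearW.
  exact: cvg_hinge_approx.
move=> /le_trans; apply.
(* The lower limit is the limit of the infima over tails, each at most its first term. *)
rewrite limn_einf_lim; apply: lime_le; first exact: is_cvg_einfs.
apply: nearW => n; apply: le_trans (integral_hinge_approx_le n).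
by apply: ereal_inf_lbound; exists n => //=.
Qed.

End hinge_comparison.

(** * Convexity of the cost *)

Section cost.
Context {R : realType}.

Lemma powR_convex (p l a b : R) : 1 <= p -> 0 <= l <= 1 -> 0 <= a -> 0 <= b ->
  (l * a + (1 - l) * b) `^ p <= l * a `^ p + (1 - l) * b `^ p.
Proof.
move=> p1 /andP[l0 l1] a0 b0.
by apply: (convex_powR p1 (Itv01 l0 l1)); rewrite inE/= in_itv/= ?a0 ?b0.
Qed.

(** Convexity of the [p]-th power makes the unit ball convex, and the norm is homogeneous. *)
Lemma minkowski2 (p x1 x2 y1 y2 : R) : 1 <= p ->
  0 <= x1 -> 0 <= x2 -> 0 <= y1 -> 0 <= y2 ->
  ((x1 + x2) `^ p + (y1 + y2) `^ p) `^ p^-1 <=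
  (x1 `^ p + y1 `^ p) `^ p^-1 + (x2 `^ p + y2 `^ p) `^ p^-1.
Proof.
move=> p1 x10 x20 y10 y20.
have p0 : 0 < p by rewrite (lt_le_trans ltr01).
pose N x y := (x `^ p + y `^ p) `^ p^-1.
have N0 x y : 0 <= N x y by exact: powR_ge0.
have NE x y : N x y `^ p = x `^ p + y `^ p.
  by rewrite -powRrM mulVf ?gt_eqF// powRr1// addr_ge0// powR_ge0.
have Neq0 x y : N x y = 0 -> x = 0 /\ y = 0.
  move=> Nxy; have := NE x y; rewrite Nxy powR0 ?gt_eqF// => /esym/eqP.
  by rewrite paddr_eq0 ?powR_ge0// => /andP[/eqP/powR_eq0_eq0 -> /eqP/powR_eq0_eq0 ->].
rewrite -!/(N _ _); move aN : (N x1 y1) => a; move bN : (N x2 y2) => b.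
(* Null vectors are set apart, since the others get divided by their norms. *)
have [a0|a0] := eqVneq a 0.
  by move: aN bN; rewrite a0 => /Neq0[-> ->] <-; rewrite !add0r.
have [b0|b0] := eqVneq b 0.
  by move: bN aN; rewrite b0 => /Neq0[-> ->] <-; rewrite !addr0.
have {}a0 : 0 < a by rewrite lt_neqAle eq_sym a0 -aN N0.
have {}b0 : 0 < b by rewrite lt_neqAle eq_sym b0 -bN N0.
have ab0 : 0 < a + b by rewrite addr_gt0.
(* Divided by a + b, the sum is the convex combination with weight l of
   the unit vectors (x1, y1) / a and (x2, y2) / b. *)
pose l := a / (a + b).
have l01 : 0 <= l <= 1 by rewrite divr_ge0 ?(ltW a0) ?(ltW ab0)//=
  ler_pdivrMr// mul1r lerDl ltW.
have H u v : 0 <= u -> 0 <= v ->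
    ((u + v) / (a + b)) `^ p <= l * (u / a) `^ p + (1 - l) * (v / b) `^ p.
  move=> u0 v0.
  have -> : (u + v) / (a + b) = l * (u / a) + (1 - l) * (v / b).
    by rewrite /l; field; rewrite !gt_eqF.
  by apply: powR_convex => //; rewrite divr_ge0 ?(ltW a0) ?(ltW b0).
have S x y c : 0 < c -> 0 <= x -> 0 <= y -> c = N x y ->
    (x / c) `^ p + (y / c) `^ p = 1.
  move=> c0 x0 y0 cN; rewrite !powRM ?invr_ge0 ?(ltW c0)// -mulrDl -NE -cN.
  by rewrite -powRM ?invr_ge0 ?(ltW c0)// divff ?gt_eqF// powR1.
have K : ((x1 + x2) / (a + b)) `^ p + ((y1 + y2) / (a + b)) `^ p <= 1.
  apply: (le_trans (lerD (H _ _ x10 x20) (H _ _ y10 y20))).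
  rewrite addrACA -!mulrDr (S _ _ _ a0)// (S _ _ _ b0)// !mulr1.
  by rewrite subrKC.
move: K; rewrite !powRM ?addr_ge0 ?invr_ge0 ?(ltW ab0)// -mulrDl -NE.
rewrite -powRM ?invr_ge0 ?(ltW ab0)// => K.
(* A norm above [a + b] would give a quotient above 1, whose [p]-th power contradicts [K]. *)
rewrite leNgt; apply/negP => abN.
have : 1 < N (x1 + x2) (y1 + y2) / (a + b) by rewrite ltr_pdivlMr// mul1r.
move=> /(gt0_ltr_powR p0); rewrite !nnegrE ler01 divr_ge0 ?(ltW ab0)// powR1.
by move=> /(_ isT isT); rewrite ltNge K.
Qed.

Variables (p q A : R).
Hypotheses (p1 : 1 <= p) (q1 : 1 <= q) (A0 : 0 <= A).

Let f (t : R) := (A + t `^ p) `^ (q / p).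

Let p0 : 0 < p. Proof. exact: lt_le_trans p1. Qed.
Let q0 : 0 < q. Proof. exact: lt_le_trans q1. Qed.

Lemma cost_nondecreasing (s t : R) : 0 <= s -> s <= t -> f s <= f t.
Proof.
move=> s0 st; have t0 := le_trans s0 st.
apply: ge0_ler_powR; rewrite ?nnegrE ?addr_ge0 ?powR_ge0 ?divr_ge0 ?(ltW p0) ?(ltW q0)//.
by rewrite lerD2l; apply: ge0_ler_powR; rewrite ?nnegrE// ltW.
Qed.

Lemma measurable_cost : measurable_fun setT f.
Proof.
apply: (measurableT_comp (measurable_powR _)).
by apply: measurable_funD => //; exact: measurable_powR.
Qed.

(** [f v] is the [q]-th power of the p-norm of the vector with coordinates [D] and [v]. This norm is
    convex in [v] by Minkowski, and the outer power is nondecreasing and convex. *)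
Lemma cost_convex (l s t : R) : 0 <= l <= 1 -> 0 <= s -> 0 <= t ->
  f (l * s + (1 - l) * t) <= l * f s + (1 - l) * f t.
Proof.
move=> l01 s0 t0; have /andP[l0 l1] := l01.
have l10 : 0 <= 1 - l by rewrite subr_ge0.
pose D := A `^ p^-1.
have DE : D `^ p = A by rewrite -powRrM mulVf ?gt_eqF// powRr1.
pose N v := (D `^ p + v `^ p) `^ p^-1.
have fN v : f v = N v `^ q by rewrite /N DE -powRrM mulrC.
have NZ c v : 0 <= c -> 0 <= v ->
    c * N v = ((c * D) `^ p + (c * v) `^ p) `^ p^-1.
  move=> c0 v0; rewrite !powRM ?powR_ge0// -mulrDr powRM ?powR_ge0//; last first.
    by rewrite addr_ge0// powR_ge0.
  by rewrite -[X in _ = X * _]powRrM mulfV ?gt_eqF// powRr1.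
rewrite !fN.
have := powR_convex q l (N s) (N t) q1 l01 (powR_ge0 _ _) (powR_ge0 _ _).
apply: le_trans.
(* The constant coordinate is split with the same weights as the variable one, so that Minkowski
   applies. *)
have DlD : D = l * D + (1 - l) * D by ring.
apply: ge0_ler_powR; rewrite ?nnegrE ?(ltW q0)// ?powR_ge0//.
  by rewrite addr_ge0// mulr_ge0// powR_ge0.
rewrite {1}/N {1}DlD !NZ//; apply: minkowski2 => //.
- by rewrite mulr_ge0// powR_ge0.
- by rewrite mulr_ge0// powR_ge0.
- by rewrite mulr_ge0.
- by rewrite mulr_ge0.
Qed.
End cost.

(** * Couplings of products with Dirac measures *)

Section dirac_products.
Context {R : realType} {d : nat}.
Implicit Types (x y : d.-tuple R) (mu nu : probability R R).

Lemma tnth_append_max x (a : R) : tnth (append (x, a)) ord_max = a.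
Proof. by rewrite (tnth_nth 0)/= nth_rcons size_tuple ltnn eqxx. Qed.

Lemma tnth_append_lift x (a : R) (j : 'I_d) :
  tnth (append (x, a)) (lift ord_max j) = tnth x j.
Proof.
rewrite !(tnth_nth 0)/= nth_rcons size_tuple.
have jd : (j < d)%N by exact: ltn_ord.
have -> : bump d j = j by rewrite /bump leqNgt jd.
by rewrite jd.
Qed.

Lemma vsub_append x y (a b : R) :
  vsub (append (x, a)) (append (y, b)) = append (vsub x y, a - b).
Proof.
apply: eq_from_tnth => i; rewrite tnth_mktuple.
have [j|] := unliftP ord_max i => [->|->]; last by rewrite !tnth_append_max.
by rewrite !tnth_append_lift tnth_mktuple.
Qed.

Lemma lp_cost_append (p q : R) x y (a b : R) : 1 <= p ->
  lp_norm p (vsub (append (x, a)) (append (y, b))) `^ q =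
  (lp_norm p (vsub x y) `^ p + `|a - b| `^ p) `^ (q / p).
Proof. by move=> p1; rewrite vsub_append lp_norm_append// -powRrM mulrC. Qed.

Lemma measurable_append_pair x : measurable_fun setT (fun a : R => append (x, a)).
Proof.
apply: (@measurableT_comp _ _ _ _ _ _ (@append R d) _ (pair x)).
  exact: measurable_append.
exact: pair1_measurable.
Qed.

Lemma dirac_prodE x mu (B : set (d.+1.-tuple R)) : measurable B ->
  dirac_prod x mu B = mu ((fun a => append (x, a)) @^-1` B).
Proof.
move=> mB.
have mB' : measurable (@append R d @^-1` B).
  by rewrite -[X in measurable X]setTI; exact: measurable_append.
transitivity (\int[\d_x]_u (mu \o xsection (@append R d @^-1` B)) u)%E; first by [].
rewrite integral_dirac//; last exact: measurable_fun_xsection.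
rewrite diracT mul1e/=; congr (mu _).
by apply/seteqP; split => a; rewrite /xsection/= inE.
Qed.

Lemma measurable_lp_cost (p q : R) k : measurable_fun setT
  (fun uv : k.-tuple R * k.-tuple R => (lp_norm p (vsub uv.1 uv.2) `^ q)%:E).
Proof.
apply/measurable_EFinP; apply: (measurableT_comp (measurable_powR _)).
apply: (@measurableT_comp _ _ _ _ _ _ (@lp_norm R k p) _
  (fun uv : k.-tuple R * k.-tuple R => vsub uv.1 uv.2)).
  exact: measurable_lp_norm.
apply/measurable_fun_tnthP => i.
rewrite (_ : _ \o _ = fun uv : k.-tuple R * k.-tuple R => tnth uv.1 i - tnth uv.2 i).
  have mt (h : k.-tuple R * k.-tuple R -> k.-tuple R) :
      measurable_fun setT h -> measurable_fun setT (fun uv => tnth (h uv) i).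
    move=> mh; apply: (@measurableT_comp _ _ _ _ _ _ (fun u : k.-tuple R => tnth u i)) mh.
    exact: measurable_tnth.
  by apply: measurable_funB; apply: mt.
by apply/funext => uv /=; rewrite tnth_mktuple.
Qed.

(** The line over [x], on which [dirac_prod x mu] is concentrated. Reusing the last coordinate of
    [v] instead of an existential makes it a finite intersection of coordinate equations, hence
    measurable. *)
Definition fibre x : set (d.+1.-tuple R) :=
  [set v | v = append (x, tnth v ord_max)].

Lemma measurable_fibre x : measurable (fibre x).
Proof.
rewrite (_ : fibre x = \bigcap_(i in [set: 'I_d.+1])
  [set v | tnth v i = tnth (append (x, tnth v ord_max)) i]); last first.
  apply/seteqP; split=> [v /= vE i _ /=|v vE]; first by rewrite -vE.
  by apply: eq_from_tnth => i; exact: vE.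
apply: fin_bigcap_measurable => // i _.
pose b (v : d.+1.-tuple R) := tnth v i == tnth (append (x, tnth v ord_max)) i.
have mb : measurable_fun setT b.
  apply: measurable_fun_eqr; first exact: measurable_tnth.
  apply: (@measurableT_comp _ _ _ _ _ _ (fun a => tnth (append (x, a)) i) _
    (fun v : d.+1.-tuple R => tnth v ord_max)); last exact: measurable_tnth.
  apply: (@measurableT_comp _ _ _ _ _ _ (fun v : d.+1.-tuple R => tnth v i)).
    exact: measurable_tnth.
  exact: measurable_append_pair.
rewrite (_ : [set v | _] = setT `&` b @^-1` [set true]); first exact: mb.
by rewrite setTI; apply/seteqP; split => v /eqP.
Qed.

Lemma dirac_prod_fibre x mu : dirac_prod x mu (~` fibre x) = 0%E.
Proof.
rewrite dirac_prodE; last by apply: measurableC; exact: measurable_fibre.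
rewrite (_ : _ @^-1` _ = set0) ?measure0//.
apply/seteqP; split => // a /=; apply.
by rewrite /fibre/= tnth_append_max.
Qed.

End dirac_products.

(** * The quantile coupling of the two products *)

Section quantile_coupling.
Context {R : realType} {d : nat} (x y : d.-tuple R) (mu nu : probability R R).
Local Notation P0 := (uniform_prob (@ltr01 R)).

(** Comonotone coupling: a single uniform variable drives both last coordinates. *)
Definition quantile_map (t : measurableTypeR R) : d.+1.-tuple R * d.+1.-tuple R :=
  (append (x, quantile01 mu t), append (y, quantile01 nu t)).

Lemma measurable_quantile_map : measurable_fun setT quantile_map.
Proof.
apply/measurable_fun_pairP; split.
  apply: (@measurableT_comp _ _ _ _ _ _ (fun a => append (x, a)) _ (quantile01 mu)).
    exact: measurable_append_pair.
  exact: measurable_quantile01.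
apply: (@measurableT_comp _ _ _ _ _ _ (fun a => append (y, a)) _ (quantile01 nu)).
  exact: measurable_append_pair.
exact: measurable_quantile01.
Qed.

HB.instance Definition _ :=
  isMeasurableFun.Build _ _ _ _ quantile_map measurable_quantile_map.

Lemma couplings_quantile_map :
  couplings (dirac_prod x mu) (dirac_prod y nu) (distribution P0 quantile_map).
Proof.
have mpre z (B : set (d.+1.-tuple R)) : measurable B ->
    measurable ((fun a => append (z, a)) @^-1` B).
  by move=> mB; rewrite -[X in measurable X]setTI; exact: measurable_append_pair.
by move=> B mB; split; rewrite dirac_prodE// -distribution_quantile01//; exact: mpre.
Qed.

End quantile_coupling.

(** * Reduction of an arbitrary coupling to its last coordinates *)

Section coupling_lower_bound.
Context {R : realType} {d : nat} {x y : d.-tuple R} {mu nu : probability R R}.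
Local Open Scope ereal_scope.
Context {rho : probability (d.+1.-tuple R * d.+1.-tuple R)%type R}.
Hypothesis rho_mu_nu : couplings (dirac_prod x mu) (dirac_prod y nu) rho.

Let X (w : d.+1.-tuple R * d.+1.-tuple R) : R := tnth w.1 ord_max.
Let Y (w : d.+1.-tuple R * d.+1.-tuple R) : R := tnth w.2 ord_max.

Let mtl : measurable_fun setT (fun v : d.+1.-tuple R => tnth v ord_max).
Proof. exact: measurable_tnth. Qed.

Let mtl_le u : measurable [set v : d.+1.-tuple R | (tnth v ord_max <= u)%R].
Proof.
rewrite (_ : [set _ | _] =
    setT `&` (fun v : d.+1.-tuple R => tnth v ord_max) @^-1` `]-oo, u]).
  exact: mtl.
by rewrite setTI; apply/seteqP; split => t/=; rewrite in_itv.
Qed.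

Lemma measurable_last_fst : measurable_fun setT X.
Proof. by apply: (measurableT_comp mtl). Qed.

Lemma measurable_last_snd : measurable_fun setT Y.
Proof. by apply: (measurableT_comp mtl). Qed.

Lemma coupling_last_fst u : rho [set w | (X w <= u)%R] = cdfm mu u.
Proof.
transitivity (pushforward rho fst
  [set v : d.+1.-tuple R | (tnth v ord_max <= u)%R]) => //.
rewrite (rho_mu_nu _ (mtl_le u)).1 dirac_prodE//; congr (mu _).
by apply/seteqP; split => a /=; rewrite tnth_append_max in_itv.
Qed.

Lemma coupling_last_snd u : rho [set w | (Y w <= u)%R] = cdfm nu u.
Proof.
transitivity (pushforward rho snd
  [set v : d.+1.-tuple R | (tnth v ord_max <= u)%R]) => //.
rewrite (rho_mu_nu _ (mtl_le u)).2 dirac_prodE//; congr (nu _).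
by apply/seteqP; split => a /=; rewrite tnth_append_max in_itv.
Qed.

(** The exceptional set is covered by two preimages, each null because the corresponding marginal is
    concentrated on its fibre. *)
Lemma coupling_fibres : {ae rho, forall w, fibre x w.1 /\ fibre y w.2}.
Proof.
have mCx := measurableC (measurable_fibre x).
have mCy := measurableC (measurable_fibre y).
have m1 : measurable (fst @^-1` (~` fibre x) : set (d.+1.-tuple R * d.+1.-tuple R)).
  by rewrite -[Z in measurable Z]setTI; exact: measurable_fst.
have m2 : measurable (snd @^-1` (~` fibre y) : set (d.+1.-tuple R * d.+1.-tuple R)).
  by rewrite -[Z in measurable Z]setTI; exact: measurable_snd.
exists (fst @^-1` (~` fibre x) `|` snd @^-1` (~` fibre y)); split.
- exact: measurableU.
- apply/eqP; rewrite measureU0//.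
    by have := (rho_mu_nu _ mCx).1; rewrite dirac_prod_fibre => /eqP.
  by have := (rho_mu_nu _ mCy).2; rewrite dirac_prod_fibre.
- move=> w /= /not_andP[]; by [left|right].
Qed.

End coupling_lower_bound.

Theorem theorem1 (R : realType) (p q : R) (d : nat)
    (p1 : 1 <= p) (q1 : 1 <= q) (d0 : (0 < d)%N)
    (x y : d.-tuple R) (mu nu : probability R R)
    (hmu : PqpR q p mu) (hnu : PqpR q p nu) :
  let c (z : R) := (lp_norm p (vsub x y) `^ p + `|z| `^ p) `^ (q / p) in
  wasserstein q p (dirac_prod x mu) (dirac_prod y nu) =
  ((\int[lebesgue_measure]_(t in `]0%R, 1%R[)
      (c (quantile mu t - quantile nu t))%:E) `^ q^-1)%E.
Proof.
move=> c; rewrite /wasserstein; congr (_ `^ _)%E.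
pose A := lp_norm p (vsub x y) `^ p.
pose f (t : R) := (A + t `^ p) `^ (q / p).
have A0 : 0 <= A by exact: powR_ge0.
have f0 t : 0 <= f t by exact: powR_ge0.
have mf : measurable_fun setT f by exact: measurable_cost.
have f_nd s t : 0 <= s -> s <= t -> f s <= f t by exact: cost_nondecreasing.
have f_cvx l s t : 0 <= l <= 1 -> 0 <= s -> 0 <= t ->
  f (l * s + (1 - l) * t) <= l * f s + (1 - l) * f t by exact: cost_convex.
have cE z : c z = f `|z| by [].
have costE a b : lp_norm p (vsub (append (x, a)) (append (y, b))) `^ q =
  f `|a - b| by exact: lp_cost_append.
clearbody c f.
have mg d' (T : measurableType d') (X Y : T -> R) : measurable_fun setT X ->
    measurable_fun setT Y ->
    measurable_fun setT (fun w => (f `|X w - Y w|)%:E : \bar R).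
  move=> mX mY; apply/measurable_EFinP; apply: measurableT_comp => //.
  by apply: measurableT_comp => //; exact: measurable_funB.
set P0 := uniform_prob (@ltr01 R).
(* The target becomes an expectation under the uniform law, to which the results on the line
   apply. *)
have -> : (\int[lebesgue_measure]_(t in `]0%R, 1%R[)
      (c (quantile mu t - quantile nu t))%:E =
    \int[P0]_t (f `|quantile01 mu t - quantile01 nu t|)%:E)%E.
  rewrite integral_uniform01; last by move=> t; rewrite lee_fin.
    by apply: eq_integral => t; rewrite inE => t01; rewrite !quantile01E// cE.
  by apply: mg; exact: measurable_quantile01.
apply/eqP; rewrite eq_le; apply/andP; split.
  (* The quantile coupling competes in the infimum, and its cost is exactly the target. *)
  apply: ereal_inf_lbound; exists (distribution P0 (quantile_map x y mu nu)).
    exact: couplings_quantile_map.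
  rewrite ge0_integral_distribution.
  - by apply: eq_integral => t _; rewrite /= costE.
  - exact: measurable_lp_cost.
  - by move=> w; rewrite lee_fin powR_ge0.
apply: le_ereal_inf_tmp => _ [pi cpi <-].
have mX := @measurable_last_fst R d; have mY := @measurable_last_snd R d.
have := @quantile_coupling_le _ _ R pi _ _ mu nu mX mY
  (coupling_last_fst cpi) (coupling_last_snd cpi) f f_nd f_cvx (fun t _ => f0 t) mf.
move=> /le_trans; apply.
(* On the two fibres the cost is a function of the last coordinates alone, so the lower bound on the
   line carries over to [pi]. *)
have aeE : {ae pi, forall w, [set: d.+1.-tuple R * d.+1.-tuple R] w ->
    (f `|tnth w.1 ord_max - tnth w.2 ord_max|)%:E =
    (lp_norm p (vsub w.1 w.2) `^ q)%:E}.
  apply: filterS (coupling_fibres cpi) => w [wx wy] _.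
  by rewrite [in RHS]wx [in RHS]wy costE.
have -> := @ge0_ae_eq_integral _ _ R pi setT _ _ measurableT (mg _ _ _ _ mX mY)
  (measurable_lp_cost p q d.+1) (fun w _ => f0 _) (fun w _ => powR_ge0 _ _) aeE.
by [].
Qed.
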